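(* Let $d\ge0$ be an integer. If a graph $G$ admits a Hoffman colouring, then $G\boxtimes K_{d+1}$ admits a $d$-improper Hoffman colouring.
   Context: Graphs are finite and simple. $\lambda_1(G)$ and $\lambda_n(G)$ denote the largest and smallest eigenvalues of the adjacency matrix of $G$. A colouring of $G$ is $d$-improper if each vertex $v$ has at most $d$ neighbours of the same colour as $v$; $\chi^d(G)$ is the least number of colours in a $d$-improper colouring of $G$. The inequality $\chi^d(G)\ge\frac{\lambda_1(G)-\lambda_n(G)}{d-\lambda_n(G)}$ always holds (Bilu), whenever the denominator is nonzero. A $d$-improper Hoffman colouring of $G$ is a $d$-improper colouring of $G$ with exactly $\frac{\lambda_1(G)-\lambda_n(G)}{d-\lambda_n(G)}$ colours (so $d-\lambda_n(G)\ne0$ and the bound is attained). A Hoffman colouring is a $0$-improper Hoffman colouring, i.e. a proper colouring of $G$ (with at least one edge) with exactly $1-\frac{\lambda_1(G)}{\lambda_n(G)}$ colours. The strong product $G\boxtimes H$ has vertex set $V(G)\times V(H)$, where $(u,u')$ and $(v,v')$ are adjacent if (i) $u=v$ and $u'\sim v'$ in $H$, or (ii) $u'=v'$ and $u\sim v$ in $G$, or (iii) $u\sim v$ in $G$ and $u'\sim v'$ in $H$. $K_{d+1}$ is the complete graph on $d+1$ vertices. *)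

(* Defs.v *)
From HB Require Import structures.
From mathcomp Require Import all_boot all_order all_algebra.

Set Implicit Arguments.
Unset Strict Implicit.
Unset Printing Implicit Defensive.

Import Order.TTheory GRing.Theory Num.Theory.
Local Open Scope ring_scope.

Record sgraph := SGraph {
  vertex :> finType;
  adj : rel vertex;
  adj_sym : symmetric adj;
  adj_irrefl : irreflexive adj
}.

Definition complete_adj (n : nat) : rel 'I_n := fun i j => i != j.

Lemma complete_adj_sym (n : nat) : symmetric (@complete_adj n).
Proof. by move=> i j; rewrite /complete_adj eq_sym. Qed.

Lemma complete_adj_irrefl (n : nat) : irreflexive (@complete_adj n).
Proof. by move=> i; rewrite /complete_adj eqxx. Qed.

Definition complete_graph (n : nat) : sgraph :=
  SGraph (@complete_adj_sym n) (@complete_adj_irrefl n).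

Definition strong_adj (G H : sgraph) : rel (G * H)%type := fun x y =>
  [|| (x.1 == y.1) && adj x.2 y.2,
      (x.2 == y.2) && adj x.1 y.1
    | adj x.1 y.1 && adj x.2 y.2].

Lemma strong_adj_sym (G H : sgraph) : symmetric (@strong_adj G H).
Proof.
move=> x y; rewrite /strong_adj (eq_sym x.1) (eq_sym x.2).
by rewrite (adj_sym x.1) (adj_sym x.2).
Qed.

Lemma strong_adj_irrefl (G H : sgraph) : irreflexive (@strong_adj G H).
Proof. by move=> x; rewrite /strong_adj !adj_irrefl !andbF. Qed.

Definition strong_product (G H : sgraph) : sgraph :=
  SGraph (@strong_adj_sym G H) (@strong_adj_irrefl G H).

Definition adj_mx (R : rcfType) (G : sgraph) : 'M[R]_#|G| :=
  \matrix_(i, j) (adj (enum_val i) (enum_val j))%:R.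

(* An adjacency matrix is symmetric, so all its eigenvalues lie in the real    *)
(* closed field R and are ordered there.                                      *)
Definition largest_eigenvalue (R : rcfType) (G : sgraph) (a : R) : Prop :=
  eigenvalue (adj_mx R G) a /\
  forall b : R, eigenvalue (adj_mx R G) b -> b <= a.

Definition smallest_eigenvalue (R : rcfType) (G : sgraph) (a : R) : Prop :=
  eigenvalue (adj_mx R G) a /\
  forall b : R, eigenvalue (adj_mx R G) b -> a <= b.

Definition improper_colouring (d : nat) (G : sgraph) (c : G -> nat) : Prop :=
  forall v : G, (#|[set u : G | adj v u & c u == c v]| <= d)%N.

(* Colours are natural numbers; only those actually used are counted.         *)
Definition num_colours (G : sgraph) (c : G -> nat) : nat :=
  size (undup (codom c)).

(* The condition d - ln != 0 is needed because x / 0 = 0 in R.                *)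
Definition improper_Hoffman_colouring (R : rcfType) (d : nat) (G : sgraph)
    (c : G -> nat) : Prop :=
  improper_colouring d c /\
  exists l1 ln : R,
    [/\ largest_eigenvalue G l1, smallest_eigenvalue G ln,
        d%:R - ln != 0 &
        (num_colours c)%:R = (l1 - ln) / (d%:R - ln)].

(* For d = 0, the condition 0 - ln != 0 says that G has at least one edge.    *)
Definition Hoffman_colouring (R : rcfType) (G : sgraph) (c : G -> nat) : Prop :=
  improper_Hoffman_colouring R 0 c.

(* Main.v *)
Require Import Defs.
From mathcomp Require Import all_boot all_order all_algebra.
From mathcomp Require Import sesquilinear spectral complex ring lra.

(** Write [m = d + 1], and let [A] be the adjacency matrix of [G].  That of the
    strong product of [G] with the complete graph on [m] vertices is
    [(A + I) (x) J - I], where [(x)] is the Kronecker product and [J] the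
    all-ones matrix of order [m].  Since [J] has eigenvalues [m] and (if
    [m > 1]) [0], the eigenvalues of the product are the [m (a + 1) - 1], for
    [a] an eigenvalue of [A], and possibly [-1].

    The map [a |-> m (a + 1) - 1] is increasing and fixes [-1], so it carries
    the extreme eigenvalues [l1] and [ln] of [G] to those of the product as soon
    as [ln <= -1 <= l1].  A graph with a Hoffman colouring has an edge, because
    [ln != 0]; the Rayleigh quotient of the difference of the two indicator
    vectors of the ends of an edge is [-1], whence [ln <= -1].  Then
    [l1 = (k - 1) (- ln)] is nonnegative, where [k >= 1] is the number of
    colours.

    Colouring each copy of the complete graph with the colour of its vertex of
    [G] gives an improper colouring with the same number of colours, as a vertex
    only shares its colour with the [d] other vertices of its copy among its
    neighbours.  The bound is also unchanged: with
    [l1' = m (l1 + 1) - 1] and [ln' = m (ln + 1) - 1] we get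
    [l1' - ln' = m (l1 - ln)] and [d - ln' = m (- ln)], and the factors [m]
    cancel. *)

Set Implicit Arguments.
Unset Strict Implicit.
Unset Printing Implicit Defensive.

Import Order.TTheory GRing.Theory Num.Theory.
Local Open Scope ring_scope.
Local Open Scope sesquilinear_scope.

(** * A variational bound for real symmetric matrices *)

Section Rayleigh.
Variables (R : rcfType) (n : nat) (A : 'M[R]_n).
Hypothesis A_sym : A^T = A.

Local Notation toC := (real_complex R).
Local Notation AC := (map_mx toC A).

Lemma map_toC_hermitian : AC \is hermsymmx.
Proof.
apply: realsym_hermsym.
  apply/is_hermitianmxP; rewrite expr0 scale1r map_mx_id //.
  by rewrite -{1}A_sym; apply/matrixP => i j; rewrite !mxE.
apply/mxOverP => i j; rewrite !mxE.
by apply/complex_realP; exists (A i j).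
Qed.

Lemma eigenvalue_spectral_diag i : eigenvalue AC (spectral_diag AC 0 i).
Proof.
have /hermitian_normalmx/orthomx_spectralP AE := map_toC_hermitian.
set P := spectralmx AC in AE *; set D := spectral_diag AC in AE *.
apply/eigenvalueP; exists (row i P).
  rewrite -row_mul {1}AE mulmxA mulmxA mulmxV ?spectral_unit // mul1mx.
  by rewrite mul_diag_mx; apply/rowP => j; rewrite !mxE.
have := spectral_unit AC; rewrite -row_free_unit -/P => /row_freeP[B PB].
apply/eqP => /(congr1 (mulmx^~ B)); rewrite -row_mul PB mul0mx.
by move/rowP/(_ i); rewrite !mxE eqxx => /eqP; rewrite oner_eq0.
Qed.

(** The spectral theorem is used over the complex numbers of [R], where [A] is
    unitarily diagonalisable with real diagonal [D].  In the coordinates [y] of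
    [x] along the eigenvectors, the two sides are the sums of the [a |y_i|^2] and
    of the [D_i |y_i|^2], and each [D_i] is an eigenvalue of [A] over [R]. *)
Lemma rayleigh_ge (a : R) (x : 'rV[R]_n) :
  (forall b, eigenvalue A b -> a <= b) ->
  a * (x *m x^T) 0 0 <= (x *m A *m x^T) 0 0.
Proof.
move=> a_min.
have /hermitian_normalmx/orthomx_spectralP AE := map_toC_hermitian.
have D_real := hermitian_spectral_diag_real map_toC_hermitian.
have P_unitary := spectral_unitarymx AC.
set P := spectralmx AC in AE P_unitary; set D := spectral_diag AC in AE D_real.
have xC : (map_mx toC x)^t* = map_mx toC x^T.
  apply/matrixP => i j; rewrite !mxE.
  by apply: conj_Creal; apply/complex_realP; exists (x j i).
pose y := map_mx toC x *m P^t*.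
have yy : toC ((x *m x^T) 0 0) = \sum_i `|y 0 i| ^+ 2.
  transitivity ((y *m y^t*) 0 0).
    rewrite /y trmx_mul map_mxM trmxCK mulmxA mulmxKtV // xC -map_mxM.
    by rewrite [RHS]mxE.
  by rewrite mxE; apply: eq_bigr => i _; rewrite !mxE normCK.
have yDy : toC ((x *m A *m x^T) 0 0) = \sum_i D 0 i * `|y 0 i| ^+ 2.
  transitivity ((y *m diag_mx D *m y^t*) 0 0).
    rewrite /y trmx_mul map_mxM trmxCK !mulmxA xC.
    rewrite -[P^t*]invmx_unitary // -(mulmxA (map_mx toC x)).
    rewrite -(mulmxA (map_mx toC x)) -AE.
    by rewrite -!map_mxM [RHS]mxE.
  rewrite mul_mx_diag mxE; apply: eq_bigr => i _; rewrite !mxE normCK.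
  by rewrite mulrAC mulrC.
rewrite -lecR rmorphM /= yy yDy mulr_sumr.
apply: ler_sum => i _; apply: ler_wpM2r; first exact: exprn_ge0.
have /mxOverP/(_ 0 i)/complex_realP[b Db] := D_real.
rewrite Db lecR; apply: a_min.
have := eigenvalue_spectral_diag i; rewrite -/D Db.
by rewrite eigenvalue_map.
Qed.

End Rayleigh.


(** * Eigenvalues of a graph *)

Section GraphSpectrum.
Variable R : rcfType.

(** The adjacency matrix is indexed by an enumeration of the vertices; functions
    on the vertices avoid it, which matters for products of graphs, whose
    enumerations are unrelated to those of the factors. *)
Lemma eigenvalue_adjP (G : sgraph) (a : R) :
  eigenvalue (adj_mx R G) a <->
  exists2 f : G -> R, (exists v, f v != 0) &
    forall v, \sum_u f u * (adj u v)%:R = a * f v.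
Proof.
split.
  case/eigenvalueP => x xA x_neq0; exists (fun v => x 0 (enum_rank v)).
    by have /rV0Pn[i xi] := x_neq0; exists (enum_val i); rewrite enum_valK.
  move=> v; have /rowP/(_ (enum_rank v)) := xA; rewrite !mxE => <-.
  rewrite (reindex _ (onW_bij _ (@enum_val_bij G))); apply: eq_bigr => i _.
  by rewrite mxE enum_valK enum_rankK.
case=> f [v fv] fA; apply/eigenvalueP; exists (\row_i f (enum_val i)).
  apply/rowP => j; rewrite !mxE -fA.
  rewrite [RHS](reindex _ (onW_bij _ (@enum_val_bij G))).
  by apply: eq_bigr => i _; rewrite !mxE.
by apply/rV0Pn; exists (enum_rank v); rewrite mxE enum_rankK.
Qed.

(** The indicator vector of [u] minus that of [v] has squared norm [2] and value
    [-2] under the quadratic form of the adjacency matrix. *)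
Lemma smallest_eigenvalue_edge (G : sgraph) (a : R) (u v : G) :
  smallest_eigenvalue G a -> adj u v -> a <= -1.
Proof.
case=> _ a_min uv.
have A_sym : (adj_mx R G)^T = adj_mx R G.
  by apply/matrixP => i j; rewrite !mxE adj_sym.
pose i := enum_rank u; pose j := enum_rank v.
pose x : 'rV[R]_#|G| := delta_mx 0 i - delta_mx 0 j.
have quad (B : 'M[R]_#|G|) :
    (x *m B *m x^T) 0 0 = B i i - B j i - (B i j - B j j).
  rewrite mulmxBl -!rowE linearB /= !trmx_delta mulmxBr -!colE.
  by rewrite !mxE.
have /negPf uvF : u != v by apply: contraL uv => /eqP->; rewrite adj_irrefl.
have xx : (x *m x^T) 0 0 = 2.
  rewrite -[X in X *m _]mulmx1 quad !mxE !eqxx (inj_eq enum_rank_inj).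
  by rewrite (inj_eq enum_rank_inj) (eq_sym v) uvF /=; lra.
have := rayleigh_ge A_sym x a_min.
by rewrite xx quad !mxE !enum_rankK !adj_irrefl (adj_sym v) uv /=; lra.
Qed.

Lemma edgeless_eigenvalue (G : sgraph) (a : R) :
  (forall u v : G, ~~ adj u v) -> eigenvalue (adj_mx R G) a -> a = 0.
Proof.
move=> noedge /eigenvalue_adjP[f [v fv] /(_ v)].
rewrite big1 => [/esym/eqP|u _]; last by rewrite (negPf (noedge u v)) mulr0.
by rewrite mulf_eq0 (negPf fv) orbF => /eqP.
Qed.

Lemma nonzero_eigenvalue_edge (G : sgraph) (a : R) :
  eigenvalue (adj_mx R G) a -> a != 0 -> exists u v : G, adj u v.
Proof.
move=> Ga a_neq0; case: (pickP (fun p : G * G => adj p.1 p.2)) => [[u v]|no].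
  by exists u, v.
case/eqP: a_neq0; apply: edgeless_eigenvalue Ga => u v.
by rewrite (no (u, v)).
Qed.

(** * Strong products with complete graphs *)

Section StrongComplete.
Variables (G : sgraph) (m : nat).
Local Notation H := (strong_product G (complete_graph m)).

(** This is the entrywise form of [(A + I) (x) J - I]. *)
Lemma strong_complete_adjE (x y : H) :
  (adj x y)%:R = (x.1 == y.1)%:R + (adj x.1 y.1)%:R - (x == y)%:R :> R.
Proof.
case: x y => u i [v j]; rewrite /= /strong_adj /= /complete_adj xpair_eqE.
case: (eqVneq u v) => [->|_] /=; case: (eqVneq i j) => _ /=;
  rewrite ?adj_irrefl //= ?(andbT, andbF, orbF) /=; lra.
Qed.

Lemma sum_strong_complete (f : H -> R) (y : H) :
  \sum_x f x * (adj x y)%:R =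
  \sum_i f (y.1, i) + \sum_u (\sum_i f (u, i)) * (adj u y.1)%:R - f y.
Proof.
have pairE (F : H -> R) : \sum_x F x = \sum_u \sum_i F (u, i).
  by rewrite pair_bigA; apply: eq_bigr => -[].
under eq_bigr do rewrite strong_complete_adjE mulrBr mulrDr.
rewrite sumrB big_split /=; congr (_ + _ - _).
- rewrite pairE (bigD1 y.1) //= [X in _ + X]big1 ?addr0 => [|u /negPf->].
    by apply: eq_bigr => i _; rewrite eqxx mulr1.
  by apply: big1 => i _; rewrite mulr0.
- by rewrite pairE; apply: eq_bigr => u _; rewrite mulr_suml.
- rewrite (bigD1 y) //= big1 ?addr0 ?eqxx ?mulr1 // => x /negPf->.
  by rewrite mulr0.
Qed.

(** An eigenfunction of [G], made constant on each copy of the complete graph, is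
    an eigenfunction of the product. *)
Lemma eigenvalue_strong_complete (a : R) : (0 < m)%N ->
  eigenvalue (adj_mx R G) a ->
  eigenvalue (adj_mx R H) (m%:R * (a + 1) - 1).
Proof.
move=> m_gt0 /eigenvalue_adjP[f [v fv] fA]; apply/eigenvalue_adjP.
exists (fun x => f x.1); first by exists (v, Ordinal m_gt0).
move=> y; rewrite sum_strong_complete /=.
have sumf u : \sum_(i < m) f u = m%:R * f u.
  by rewrite sumr_const card_ord mulr_natl.
under [X in _ + X - _]eq_bigr do rewrite sumf -mulrA.
by rewrite sumf -mulr_sumr fA; ring.
Qed.

(** Let [w] sum an eigenfunction over each copy of the complete graph.  The
    eigenvalue equation, summed over a copy, says that [(b + 1) w] is [m] times
    the image of [w] under [A + I].  So [w] is an eigenfunction of [G], unless it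
    vanishes; in that case the equation itself reads [(b + 1) f = 0]. *)
Lemma eigenvalue_strong_complete_inv (b : R) :
  eigenvalue (adj_mx R H) b ->
  b = -1 \/ exists2 a, eigenvalue (adj_mx R G) a & b = m%:R * (a + 1) - 1.
Proof.
move=> /eigenvalue_adjP[f [x0 fx0] fA].
pose w u := \sum_i f (u, i).
have fw u i : (b + 1) * f (u, i) = w u + \sum_t w t * (adj t u)%:R.
  by have := fA (u, i); rewrite sum_strong_complete /= -/(w u) => fui; lra.
have ww u : (b + 1) * w u = m%:R * (w u + \sum_t w t * (adj t u)%:R).
  rewrite mulr_sumr; under eq_bigr do rewrite fw.
  by rewrite sumr_const card_ord mulr_natl.
case: (pickP (fun u => w u != 0)) => [u wu|w0]; [right|left].
  have m_neq0 : m%:R != 0 :> R.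
    by rewrite pnatr_eq0 -lt0n (leq_ltn_trans _ (ltn_ord x0.2)).
  exists ((b + 1) / m%:R - 1); last by field.
  apply/eigenvalue_adjP; exists w; first by exists u.
  move=> v; apply: (mulfI m_neq0).
  transitivity ((b + 1) * w v - m%:R * w v); first by rewrite ww; ring.
  by field.
case: x0 fx0 => u i fx0; have := fw u i.
have {}w0 t : w t = 0 by apply/eqP; have /negbFE := w0 t.
rewrite w0 big1 ?addr0 => [/eqP|t _]; last by rewrite w0 mul0r.
by rewrite mulf_eq0 (negPf fx0) orbF addr_eq0 => /eqP.
Qed.

(** The hypothesis on [a] is there for the eigenvalue [-1], which does not come
    from [G]; the same holds for the smallest eigenvalue. *)
Lemma largest_eigenvalue_strong_complete (a : R) : (0 < m)%N -> -1 <= a ->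
  largest_eigenvalue G a -> largest_eigenvalue H (m%:R * (a + 1) - 1).
Proof.
move=> m_gt0 a_ge [Ga a_max]; split; first exact: eigenvalue_strong_complete.
have m_ge0 : 0 <= m%:R :> R by [].
move=> b /eigenvalue_strong_complete_inv[->|[c /a_max ca ->]]; nra.
Qed.

Lemma smallest_eigenvalue_strong_complete (a : R) : (0 < m)%N -> a <= -1 ->
  smallest_eigenvalue G a -> smallest_eigenvalue H (m%:R * (a + 1) - 1).
Proof.
move=> m_gt0 a_le [Ga a_min]; split; first exact: eigenvalue_strong_complete.
have m_ge0 : 0 <= m%:R :> R by [].
move=> b /eigenvalue_strong_complete_inv[->|[c /a_min ca ->]]; nra.
Qed.

Lemma num_colours_strong_complete (c : G -> nat) : (0 < m)%N ->
  num_colours (fun x : H => c x.1) = num_colours c.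
Proof.
move=> m_gt0; apply/perm_size/uniq_perm; rewrite ?undup_uniq // => k.
rewrite !mem_undup; apply/codomP/codomP => [[x ->]|[u ->]]; first by exists x.1.
by exists (u, Ordinal m_gt0).
Qed.

End StrongComplete.

(** The colouring of [G] being proper, the neighbours of [(v, j)] with its colour
    all lie in the copy of the complete graph over [v]. *)
Lemma improper_colouring_strong_complete (G : sgraph) (d : nat)
    (c : G -> nat) :
  improper_colouring 0 c ->
  improper_colouring d
    (fun x : strong_product G (complete_graph d.+1) => c x.1).
Proof.
move=> c_proper [v j].
have cvF u : adj v u -> c u != c v.
  move=> vu; have := c_proper v; rewrite leqn0 cards_eq0 => /eqP/setP/(_ u).
  by rewrite !inE vu => /negbT.
pose H := strong_product G (complete_graph d.+1).
have sub : [set x : H | adj ((v, j) : H) x & c x.1 == c v]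
             \subset [set (v, i) | i in ~: [set j]].
  apply/subsetP => -[u i]; rewrite inE /= /strong_adj /= /complete_adj.
  case/andP=> vjui cuv; have vuF : adj v u = false.
    by apply: contraTF cuv => /cvF.
  move: vjui; rewrite vuF andbF orbF => /andP[/eqP<- ji].
  by apply: imset_f; rewrite !inE eq_sym.
apply: leq_trans (subset_leq_card sub) _.
by apply: leq_trans (leq_imset_card _ _) _; rewrite cardsC1 card_ord.
Qed.

End GraphSpectrum.

Theorem lemma11 (R : rcfType) (d : nat) (G : sgraph) :
  (exists c : G -> nat, Hoffman_colouring R c) ->
  exists c : strong_product G (complete_graph d.+1) -> nat,
    improper_Hoffman_colouring R d c.
Proof.
case=> c [c_proper [l1 [ln [G_l1 G_ln]]]].
rewrite sub0r oppr_eq0 => ln_neq0 c_num.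
have [u [v uv]] := nonzero_eigenvalue_edge G_ln.1 ln_neq0.
have ln_le := smallest_eigenvalue_edge G_ln uv.
have k_ge1 : 1 <= (num_colours c)%:R :> R.
  rewrite ler1n lt0n size_eq0; apply/eqP => c0.
  by have := codom_f c u; rewrite -mem_undup c0.
have l1E : l1 = ((num_colours c)%:R - 1) * - ln by rewrite c_num; field.
have l1_ge : -1 <= l1 by rewrite l1E; nra.
exists (fun x => c x.1); split; first exact: improper_colouring_strong_complete.
exists (d.+1%:R * (l1 + 1) - 1), (d.+1%:R * (ln + 1) - 1).
have denE : d%:R - (d.+1%:R * (ln + 1) - 1) = d.+1%:R * - ln.
  by rewrite -natr1; ring.
have d_neq0 : d.+1%:R != 0 :> R by rewrite pnatr_eq0.
split; first exact: largest_eigenvalue_strong_complete.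
- exact: smallest_eigenvalue_strong_complete.
- by rewrite denE mulf_neq0 ?oppr_eq0.
- rewrite num_colours_strong_complete // denE c_num; field.
  by rewrite ln_neq0 nat1r.
Qed.
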